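(* Let $1\le K\le M$, let $\bm{\Psi}\in\mathbb{R}^{M\times K}$ be the truncated DCT basis (so $\bm{\Psi}^\top\bm{\Psi}=\bm I$), let $\mathcal S\subseteq\{1,\dots,M\}$ with $|\mathcal S|=N_s$, and suppose that the row-submatrix $\bm{\Psi}_{\mathcal S}\in\mathbb{R}^{N_s\times K}$ has full column rank. Given an observation $\bm y_{\mathcal S}\in\mathbb{R}^{N_s}$, define $$\widehat{\bm\omega}=(\bm\Psi_{\mathcal S}^\top\bm\Psi_{\mathcal S})^{-1}\bm\Psi_{\mathcal S}^\top\bm y_{\mathcal S},\qquad \widehat{\bm g}=\bm\Psi\widehat{\bm\omega}.$$ (i) Suppose the retained $K$-dimensional model $\bm g=\bm\Psi\bm\omega$ holds for a deterministic $\bm\omega\in\mathbb{R}^K$, and $\bm y_{\mathcal S}=\bm g_{\mathcal S}+\bm z=\bm\Psi_{\mathcal S}\bm\omega+\bm z$ with $\bm z\sim\mathcal N(\bm 0,\sigma^2\bm I)$. Then $\widehat{\bm\omega}$ is unbiased, i.e. $\mathbb{E}[\widehat{\bm\omega}]=\bm\omega$, and $$\mathrm{Cov}(\widehat{\bm\omega})=\sigma^2\left(\bm\Psi_{\mathcal S}^\top\bm\Psi_{\mathcal S}\right)^{-1},\qquad \mathbb{E}\left[\|\widehat{\bm g}-\bm g\|_2^2\right]=\sigma^2\,\mathrm{Tr}\left[\left(\bm\Psi_{\mathcal S}^\top\bm\Psi_{\mathcal S}\right)^{-1}\right].$$ (ii) Suppose instead that $\bm g=\bm\Psi\bm\omega+\bm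 e_K$, where $\bm\omega=\bm\Psi^\top\bm g$ is the vector of the first $K$ DCT coefficients of $\bm g$ and $\bm e_K=\bm g-\bm\Psi\bm\omega$ is the truncation error, and that $\bm y_{\mathcal S}=\bm\Psi_{\mathcal S}\bm\omega+\tilde{\bm z}$ with residual $\tilde{\bm z}=(\bm e_K)_{\mathcal S}+\bm z$. Then $$\|\widehat{\bm g}-\bm g\|_2\le\frac{\|(\bm e_K)_{\mathcal S}\|_2+\|\bm z\|_2}{\sigma_{\min}(\bm\Psi_{\mathcal S})}+\|\bm e_K\|_2.$$
   Context: $\bm g\in\mathbb{R}_+^M$ is an unknown (deterministic) vector with nonnegative entries, the discretized antenna power pattern. The orthonormal DCT-II matrix $\bm C\in\mathbb{R}^{M\times M}$ has entries $[\bm C]_{m,k}=\rho_k\cos\left[\frac{\pi}{M}(m-\frac12)(k-1)\right]$ for $m,k=1,\dots,M$, with $\rho_1=\sqrt{1/M}$ and $\rho_k=\sqrt{2/M}$ for $k>1$; it satisfies $\bm C^\top\bm C=\bm I$. The truncated DCT basis $\bm\Psi\in\mathbb{R}^{M\times K}$ consists of the first $K$ columns of $\bm C$. For an index set $\mathcal S\subseteq\{1,\dots,M\}$, $\bm\Psi_{\mathcal S}$ is the submatrix of rows of $\bm\Psi$ indexed by $\mathcal S$, and for a vector $\bm v\in\mathbb{R}^M$, $\bm v_{\mathcal S}$ is the subvector of entries indexed by $\mathcal S$. $\sigma^2>0$ is the noise variance, $\sigma_{\min}(\cdot)$ is the minimum singular value (for an $N_s\times K$ matrix with $N_s\ge K$,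 the smallest of its $K$ singular values), and $\|\cdot\|_2$ is the Euclidean norm. *)

(* Defs.v *)
From HB Require Import structures.
From mathcomp Require Import all_boot all_order all_algebra.
From mathcomp Require Import all_classical all_reals all_analysis.

Set Implicit Arguments.
Unset Strict Implicit.
Unset Printing Implicit Defensive.

Import Order.TTheory GRing.Theory Num.Theory.
Import numFieldNormedType.Exports.

Local Open Scope classical_set_scope.
Local Open Scope ring_scope.

(* Orthonormal DCT-II matrix. The usual indices m, k = 1..M are shifted to
   0..M-1, so that (m - 1/2)(k - 1) becomes (m + 1/2) k. *)
Definition dct_scale (R : realType) (M k : nat) : R :=
  Num.sqrt ((if k == 0%N then 1 else 2) / M%:R).

Definition dct2 (R : realType) (M : nat) : 'M[R]_M :=
  \matrix_(m < M, k < M)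
    (dct_scale R M k * cos (pi / M%:R * (m%:R + 2^-1) * k%:R)).

Definition trunc_dct (R : realType) (M K : nat) (hKM : (K <= M)%N)
  : 'M[R]_(M, K) := colsub (widen_ord hKM) (dct2 R M).

(* The rows of A indexed by S, listed in the order of [enum S]; on a column
   vector this is the subvector indexed by S. *)
Definition subrows (R : Type) (M n : nat) (S : {set 'I_M}) (A : 'M[R]_(M, n))
  : 'M[R]_(#|S|, n) := rowsub (fun i : 'I_#|S| => enum_val i) A.

Definition least_squares (R : realType) (N K : nat) (A : 'M[R]_(N, K))
    (y : 'cV[R]_N) : 'cV[R]_K :=
  invmx (A^T *m A) *m A^T *m y.

(* The MathComp norm on matrices is the sup norm. *)
Definition norm2 (R : realType) (n : nat) (v : 'cV[R]_n) : R :=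
  Num.sqrt (\sum_(i < n) v i 0 ^+ 2).

(* The K singular values of an N x K matrix with N >= K are the square roots of
   the eigenvalues of A^T A. For K > 0 this set is finite and nonempty, so that
   its infimum is the smallest of them. *)
Definition singular_values (R : realType) (N K : nat) (A : 'M[R]_(N, K))
  : set R := [set Num.sqrt a | a in [set a | eigenvalue (A^T *m A) a]].

Definition sigma_min (R : realType) (N K : nat) (A : 'M[R]_(N, K)) : R :=
  inf (singular_values A).

Section random_vectors.
Context (d : measure_display) (T : measurableType d) (R : realType)
  (P : probability T R).

(* Entrywise expectation and covariance matrix, with entries in \bar R. *)
Definition mean_vec (n : nat) (X : T -> 'cV[R]_n) : 'cV[\bar R]_n :=
  \col_i expectation P (fun w => X w i 0).

Definition cov_mx (n : nat) (X : T -> 'cV[R]_n) : 'M[\bar R]_n :=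
  \matrix_(i, j) covariance P (fun w => X w i 0) (fun w => X w j 0).

(* The subfamilies are covered by taking some of the A i to be the whole
   line. *)
Definition mutually_independent (n : nat) (X : 'I_n -> {RV P >-> R}) : Prop :=
  forall A : 'I_n -> set R, (forall i, measurable (A i)) ->
    P (\bigcap_(i in [set: 'I_n]) (X i @^-1` A i)) =
    (\prod_(i < n) P (X i @^-1` A i))%E.

(* z ~ N(0, sigma^2 I); the second argument of [normal_prob] is the standard
   deviation. *)
Definition white_gaussian (n : nat) (sigma : R) (z : 'I_n -> {RV P >-> R})
  : Prop :=
  (forall i (A : set R), measurable A ->
     distribution P (z i) A = normal_prob 0 sigma A) /\
  mutually_independent z.

End random_vectors.

(* Main.v *)
(* Write A = Psi_S and L = (A^T A)^-1 A^T, so that L A = 1 and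
   omega_hat = omega + L z. White noise has E[z_k z_l] = sigma^2 delta_kl
   (off the diagonal because the joint law of an independent pair is the product
   of its marginals), hence L z has mean 0 and covariance
   sigma^2 L L^T = sigma^2 (A^T A)^-1; the mean square error is the trace of
   that covariance since Psi is an isometry.
   For (ii), A L u is the orthogonal projection of u on the range of A, so
   |A L u| <= |u|. A minimiser of the quadratic form of A^T A on the unit sphere
   is an eigenvector, whence sigma_min(A) |v| <= |A v| for all v and
   |L u| <= |u| / sigma_min(A). *)

Require Import Defs.
From HB Require Import structures.
From mathcomp Require Import all_boot all_order all_algebra.
From mathcomp Require Import all_classical all_reals all_analysis.
From mathcomp Require Import measurable_realfun ring lra zify.
Import Order.TTheory GRing.Theory Num.Theory.
Import numFieldNormedType.Exports.
Local Open Scope classical_set_scope.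
Local Open Scope ring_scope.
Set Implicit Arguments.
Unset Strict Implicit.
Unset Printing Implicit Defensive.

(** * Orthonormality of the DCT-II basis *)

(** Since 2 sin(a/2) cos(a(m + 1/2)) = sin(a(m+1)) - sin(am), the sum telescopes. *)
Lemma sum_cos_half_shift (R : realType) (a : R) (M : nat) :
  2 * sin (a / 2) * (\sum_(m < M) cos (a * (m%:R + 2^-1))) = sin (a * M%:R).
Proof.
pose f (m : nat) : R := sin (a * m%:R).
have -> : sin (a * M%:R) = \sum_(0 <= m < M) (f m.+1 - f m).
  by rewrite telescope_sumr// /f mulr0 sin0 subr0.
rewrite mulr_sumr big_mkord; apply: eq_bigr => m _; rewrite /f.
have -> : a * m.+1%:R = a * (m%:R + 2^-1) + a / 2 by rewrite -natr1; field.
have -> : a * m%:R = a * (m%:R + 2^-1) - a / 2 by field.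
by rewrite sinD sinB; ring.
Qed.

Lemma sin_natpi (R : realType) (n : nat) : sin (n%:R * pi : R) = 0.
Proof.
elim: n => [|n IHn]; first by rewrite mul0r sin0.
by rewrite -natr1 mulrDl mul1r sinDpi IHn oppr0.
Qed.

(** For a = pi n / M the telescoped sum is sin(n pi) = 0. The range of n places a/2 strictly between
    0 and pi, so the factor sin(a/2) can be cancelled. *)
Lemma sum_cos_dct (R : realType) (M n : nat) : (0 < n < M.*2)%N ->
  \sum_(m < M) cos (pi / M%:R * (m%:R + 2^-1) * n%:R) = 0 :> R.
Proof.
move=> /andP[n0 nM].
have M0 : (0 < M)%N by rewrite -double_gt0 (leq_trans _ nM).
have M0R : M%:R != 0 :> R by rewrite pnatr_eq0 -lt0n.
pose a : R := pi / M%:R * n%:R.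
rewrite (eq_bigr (fun m : 'I_M => cos (a * (m%:R + 2^-1)))); last first.
  by move=> m _; rewrite mulrAC.
have : 2 * sin (a / 2) * (\sum_(m < M) cos (a * (m%:R + 2^-1))) = 0.
  rewrite sum_cos_half_shift (_ : a * M%:R = n%:R * pi) ?sin_natpi//.
  by rewrite /a; field.
move/eqP; rewrite !mulf_eq0 pnatr_eq0/= => /orP[|/eqP//].
suff /gt_eqF -> : 0 < sin (a / 2) by [].
apply: sin_gt0_pi; rewrite /a; apply/andP; split.
  by rewrite !mulr_gt0// ?pi_gt0 ?invr_gt0 ?ltr0n.
have -> : pi / M%:R * n%:R / 2 = pi * (n%:R / M.*2%:R) :> R.
  by rewrite -muln2 natrM; field.
by rewrite gtr_pMr ?pi_gt0// ltr_pdivrMr ?ltr0n ?double_gt0// mul1r ltr_nat.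
Qed.

(** The product-to-sum formula reduces the inner product of columns i and j to cosine sums at the
    frequencies i - j and i + j. For i different from j both sums vanish. *)
Lemma dct2_orthonormal (R : realType) (M : nat) :
  (dct2 R M)^T *m dct2 R M = 1%:M.
Proof.
(* The Gram matrix is symmetric. With j <= i the truncated subtraction [i - j] is the true one. *)
suff dotE (i j : 'I_M) : (j <= i)%N ->
    ((dct2 R M)^T *m dct2 R M) i j = (1%:M : 'M[R]_M) i j.
  apply/matrixP => i j; have [|/ltnW] := leqP j i; first exact: dotE.
  move=> /dotE; rewrite -[in LHS](trmxK (dct2 R M)) -trmx_mul trmxK mxE => ->.
  by rewrite !mxE eq_sym.
move=> ji; have M0 : (0 < M)%N by exact: leq_ltn_trans (ltn_ord i).
have M0R : M%:R != 0 :> R by rewrite pnatr_eq0 -lt0n.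
rewrite !mxE.
pose c (n : nat) : R := \sum_(m < M) cos (pi / M%:R * (m%:R + 2^-1) * n%:R).
transitivity
  (dct_scale R M i * dct_scale R M j / 2 * (c (i - j)%N + c (i + j)%N)).
  rewrite /c -big_split mulr_sumr; apply: eq_bigr => m _; rewrite !mxE/=.
  move: (pi / _ * (_ + _)) => t.
  rewrite natrB// natrD mulrBr (mulrDr t) cosB cosD.
  by field.
have c0 : c 0%N = M%:R.
  rewrite /c (eq_bigr (fun=> 1)) ?sumr_const ?card_ord// => m _.
  by rewrite mulr0 cos0.
(* On the diagonal the frequency 0 contributes M. In column 0 the other frequency is 0 as well and
   contributes M again, which the smaller value of [dct_scale] compensates. *)
have [->|ij] := eqVneq i j.
  rewrite subnn -expr2 c0 /dct_scale sqr_sqrtr; last first.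
    by rewrite divr_ge0//; case: ifP.
  have [->|j0] := eqVneq (j : nat) 0%N.
    by rewrite addn0 c0 /=; field.
  rewrite addnn /c sum_cos_dct ?addr0 /=; first by field.
  by rewrite ltn_double double_gt0 lt0n j0/=.
have {}ji : (j < i)%N by rewrite ltn_neqAle ji andbT eq_sym.
have iM := ltn_ord i.
rewrite /c !sum_cos_dct ?addr0 ?mulr0//; last by lia.
by lia.
Qed.

Lemma trunc_dct_orthonormal (R : realType) (M K : nat) (hKM : (K <= M)%N) :
  (trunc_dct R hKM)^T *m trunc_dct R hKM = 1%:M.
Proof.
apply/matrixP => i j; rewrite !mxE.
have /matrixP /(_ (widen_ord hKM i) (widen_ord hKM j)) := dct2_orthonormal R M.
rewrite !mxE/= => <-.
by apply: eq_bigr => m _; rewrite !mxE.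
Qed.

(** * The Euclidean norm *)

Lemma norm2_ge0 (R : realType) (n : nat) (v : 'cV[R]_n) : 0 <= norm2 v.
Proof. exact: sqrtr_ge0. Qed.

Lemma norm2_sqr (R : realType) (n : nat) (v : 'cV[R]_n) :
  norm2 v ^+ 2 = (v^T *m v) 0 0.
Proof.
rewrite /norm2 sqr_sqrtr ?sumr_ge0// => [|i _]; last exact: sqr_ge0.
by rewrite mxE; apply: eq_bigr => i _; rewrite mxE expr2.
Qed.

Lemma norm2_eq0 (R : realType) (n : nat) (v : 'cV[R]_n) :
  (norm2 v == 0) = (v == 0).
Proof.
apply/idP/eqP => [|->]; last first.
  by rewrite -sqrf_eq0 norm2_sqr mulmx0 mxE.
rewrite -sqrf_eq0 /norm2 sqr_sqrtr ?sumr_ge0// => [|i _]; last exact: sqr_ge0.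
rewrite psumr_eq0 => [/allP v0|i _]; last exact: sqr_ge0.
apply/colP => i; rewrite mxE; apply/eqP; rewrite -sqrf_eq0.
by apply: v0; rewrite mem_index_enum.
Qed.

Lemma norm2_isometry (R : realType) (m n : nat) (A : 'M[R]_(m, n))
    (v : 'cV[R]_n) : A^T *m A = 1%:M -> norm2 (A *m v) = norm2 v.
Proof.
move=> AA1; apply/eqP; rewrite -(eqrXn2 (n := 2)) ?norm2_ge0// !norm2_sqr.
by rewrite trmx_mul -mulmxA (mulmxA A^T) AA1 mul1mx.
Qed.

Lemma dotmx_ge0 (R : realType) (n : nat) (v : 'cV[R]_n) : 0 <= (v^T *m v) 0 0.
Proof. by rewrite -norm2_sqr sqr_ge0. Qed.

(** For nonzero u and v, expand the squared norm of |v| u - |u| v, which is nonnegative, and divide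
    by 2 |u| |v|. *)
Lemma cauchy_schwarz (R : realType) (n : nat) (u v : 'cV[R]_n) :
  (u^T *m v) 0 0 <= norm2 u * norm2 v.
Proof.
have [/eqP|v0] := eqVneq (norm2 v) 0.
  by rewrite norm2_eq0 => /eqP ->; rewrite mulmx0 mxE mulr_ge0 ?norm2_ge0.
have [/eqP|u0] := eqVneq (norm2 u) 0.
  by rewrite norm2_eq0 => /eqP ->; rewrite trmx0 mul0mx mxE mulr_ge0 ?norm2_ge0.
have uv_gt0 : 0 < norm2 u * norm2 v.
  by rewrite mulr_gt0// lt_def ?u0 ?v0 norm2_ge0.
have := dotmx_ge0 (norm2 v *: u - norm2 u *: v).
have uvC : (v^T *m u) 0 0 = (u^T *m v) 0 0.
  by rewrite -[in LHS](trmxK u) -trmx_mul mxE.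
have -> : (norm2 v *: u - norm2 u *: v)^T = norm2 v *: u^T - norm2 u *: v^T.
  by apply/matrixP => i j; rewrite !mxE.
rewrite mulmxBl !mulmxBr -!scalemxAl -!scalemxAr.
move: uvC (norm2_sqr u) (norm2_sqr v).
move: (u^T *m u) (u^T *m v) (v^T *m u) (v^T *m v) => uu uv vu vv vuE nu nv.
rewrite !mxE vuE -nu -nv -(ler_pM2l uv_gt0 (uv 0 0)).
move: (norm2 u) (norm2 v) (uv 0 0) => a b x abx; lra.
Qed.

Lemma norm2D (R : realType) (n : nat) (u v : 'cV[R]_n) :
  norm2 (u + v) <= norm2 u + norm2 v.
Proof.
rewrite -(ler_pXn2r (n := 2)) ?nnegrE ?addr_ge0 ?norm2_ge0//.
have uvC : (v^T *m u) 0 0 = (u^T *m v) 0 0.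
  by rewrite -[in LHS](trmxK u) -trmx_mul mxE.
rewrite norm2_sqr [(u + v)^T]raddfD/= mulmxDl !mulmxDr.
move: uvC (norm2_sqr u) (norm2_sqr v) (cauchy_schwarz u v).
move: (u^T *m u) (u^T *m v) (v^T *m u) (v^T *m v) => uu uv vu vv vuE nu nv.
by rewrite !mxE vuE -nu -nv; nra.
Qed.

Lemma norm2N (R : realType) (n : nat) (v : 'cV[R]_n) : norm2 (- v) = norm2 v.
Proof.
by rewrite /norm2; congr Num.sqrt; apply: eq_bigr => i _; rewrite mxE sqrrN.
Qed.

(** * Gram matrices, least eigenvalues and least singular values *)

Lemma full_rank_mul_inj (R : realType) (N K : nat) (A : 'M[R]_(N, K))
    (v : 'cV[R]_K) : \rank A = K -> A *m v = 0 -> v = 0.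
Proof.
move=> rA Av0; apply: trmx_inj; rewrite trmx0.
have fA : row_free A^T by rewrite /row_free mxrank_tr rA.
apply/eqP; rewrite -(mulmx_free_eq0 _ fA) -trmx_mul Av0 trmx0//.
Qed.

(** If v A^T A = 0 then |A v^T|^2 = v A^T A v^T = 0, so v = 0 by full column rank. *)
Lemma gram_unitmx (R : realType) (N K : nat) (A : 'M[R]_(N, K)) :
  \rank A = K -> A^T *m A \in unitmx.
Proof.
move=> rA; rewrite -row_free_unit; apply: inj_row_free => v vAA0.
apply: trmx_inj; rewrite trmx0; apply: (full_rank_mul_inj rA).
apply/eqP; rewrite -norm2_eq0 -sqrf_eq0 norm2_sqr trmx_mul trmxK.
by rewrite mulmxA -(mulmxA v) vAA0 mul0mx mxE.
Qed.

(** At c the form attains its minimum 0. Were u = c C nonzero, a small move from c in the direction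
    -u would make the form negative. *)
Lemma psd_isotropic_ker (R : realType) (n : nat) (C : 'M[R]_n) (c : 'rV[R]_n) :
  C^T = C -> (forall v : 'rV_n, 0 <= (v *m C *m v^T) 0 0) ->
  (c *m C *m c^T) 0 0 = 0 -> c *m C = 0.
Proof.
move=> symC C_ge0 cCc0; pose u := c *m C.
have uE : c *m C = u by [].
have CcE : C *m c^T = u^T by rewrite /u trmx_mul symC.
have uCc : (u *m C *m c^T) 0 0 = (u *m u^T) 0 0 by rewrite -mulmxA CcE.
have uu_ge0 : 0 <= (u *m u^T) 0 0.
  by have := dotmx_ge0 u^T; rewrite trmxK.
(* With k = u C u^T, the form at c - t u is -2t |u|^2 + t^2 k. This choice gives |u|^2 = t(1 + k),
   so the value is -t^2 (2 + k) and nonnegativity forces t = 0. The summand 1 keeps the denominator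
   positive. *)
pose t := (u *m u^T) 0 0 / (1 + (u *m C *m u^T) 0 0).
have k1 : 0 < 1 + (u *m C *m u^T) 0 0 by rewrite ltr_wpDr.
have := C_ge0 (c - t *: u).
have -> : (c - t *: u)^T = c^T - t *: u^T.
  by apply/matrixP => i j; rewrite !mxE.
rewrite mulmxBl -!scalemxAl mulmxBr !mulmxBl -!scalemxAl -!scalemxAr.
move: cCc0 uCc; rewrite uE => cCc0 uCc.
have tE : t * (1 + (u *m C *m u^T) 0 0) = (u *m u^T) 0 0.
  by rewrite /t divfK// gt_eqF.
have ker : (u *m u^T) 0 0 = 0 -> u = 0.
  have := norm2_sqr u^T; rewrite trmxK => <- /eqP.
  by rewrite sqrf_eq0 norm2_eq0 trmx_eq0 => /eqP.
have t_ge0 : 0 <= t by rewrite divr_ge0// ltW.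
move=> H; apply: ker; move: H uu_ge0 tE uCc cCc0 (C_ge0 u).
clearbody t.
move: (u *m C *m u^T) (u *m C *m c^T) (u *m c^T) (u *m u^T) t t_ge0.
move=> k a b s {}t t0.
rewrite !mxE => H s0 tE aE b0 k0; move: H; rewrite aE b0 -tE.
move: (k 0 0) k0 => x x0 H.
have : t ^+ 2 * (2 + x) <= 0 by nra.
rewrite pmulr_lle0; last by lra.
rewrite le_eqVlt sqrf_eq0 ltNge sqr_ge0 orbF => /eqP ->.
by rewrite mul0r.
Qed.

Lemma continuous_sum (R : realType) (T : topologicalType) (I : finType)
    (F : I -> T -> R) :
  (forall i, continuous (F i)) -> continuous (fun x => \sum_i F i x).
Proof.
move=> cF; apply: (@continuous_big R I +%R 0 xpredT (@add_continuous _)) => i _.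
exact: cF.
Qed.

Lemma continuous_quadratic_form (R : realType) (n : nat) (B : 'M[R]_n) :
  continuous (fun v : 'rV[R]_n => (v *m B *m v^T) 0 0).
Proof.
have -> : (fun v : 'rV[R]_n => (v *m B *m v^T) 0 0) =
    (fun v : 'rV[R]_n => \sum_j (\sum_i v 0 i * B i j) * v 0 j).
  by apply/funext => v; rewrite mxE; apply: eq_bigr => j _; rewrite !mxE.
apply: (@continuous_sum _ _ _
  (fun j (v : 'rV[R]_n) => (\sum_i v 0 i * B i j) * v 0 j)) => j.
have cB : continuous (fun v : 'rV[R]_n => \sum_i v 0 i * B i j).
  apply: (@continuous_sum _ _ _
    (fun i (v : 'rV[R]_n) => v 0 i * B i j)) => i v.
  by apply: continuousM; [exact: coord_continuous | exact: cst_continuous].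
by move=> v; apply: continuousM; [exact: cB | exact: coord_continuous].
Qed.

(** Let a be the minimum of the form on the unit sphere, attained at c by compactness. By
    homogeneity B - a is positive semidefinite, and c is isotropic for it, hence lies in its kernel:
    c is an eigenvector for a. *)
Lemma symmetric_min_eigenvalue (R : realType) (n : nat) (B : 'M[R]_n) :
  (0 < n)%N -> B^T = B -> exists2 a, eigenvalue B a &
    forall v : 'rV[R]_n, a * (v *m v^T) 0 0 <= (v *m B *m v^T) 0 0.
Proof.
move=> n0 symB.
have q_ge0 (v : 'rV[R]_n) : 0 <= (v *m v^T) 0 0.
  by have := dotmx_ge0 v^T; rewrite trmxK.
have q_eq0 (v : 'rV[R]_n) : (v *m v^T) 0 0 = 0 -> v = 0.
  have := norm2_sqr v^T; rewrite trmxK => <- /eqP.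
  by rewrite sqrf_eq0 norm2_eq0 trmx_eq0 => /eqP.
have qE (v : 'rV[R]_n) : (v *m v^T) 0 0 = (v *m 1%:M *m v^T) 0 0.
  by rewrite mulmx1.
have cq : continuous (fun v : 'rV[R]_n => (v *m v^T) 0 0).
  by under eq_fun do rewrite qE; exact: continuous_quadratic_form.
pose S := [set v : 'rV[R]_n | (v *m v^T) 0 0 = 1].
have S0 : S !=set0.
  exists (delta_mx 0 (Ordinal n0)).
  by rewrite /S /= trmx_delta mul_delta_mx mxE !eqxx.
have cS : compact S.
  apply: bounded_closed_compact; last first.
    have := @preimage_closed _ _ (fun v : 'rV[R]_n => (v *m v^T) 0 0)
      [set x | x = 1].
    by apply=> [v _|]; [exact: cq | exact: closed_eq].
  (* Boundedness refers to the sup norm: the square of each coordinate is at most the sum of all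
     squares, which is 1. *)
  exists 1; split => // M M1 v Sv /=; rewrite (le_trans _ (ltW M1))//.
  rewrite -[leLHS]/(mx_norm v) mx_normrE; apply: bigmax_le => // -[i j] _ /=.
  rewrite ord1 -(ler_pXn2r (n := 2)) ?nnegrE// expr1n real_normK ?num_real//.
  move: Sv; rewrite /S/= mxE => <-.
  rewrite (bigD1 j)//= !mxE -expr2 lerDl sumr_ge0// => k _.
  by rewrite mxE -expr2 sqr_ge0.
have [c Sc minc] := EVT_min_rV S0 cS
  (continuous_subspaceT (@continuous_quadratic_form _ _ B)).
move: Sc; rewrite inE => Sc.
pose a := (c *m B *m c^T) 0 0.
have aP (v : 'rV[R]_n) : a * (v *m v^T) 0 0 <= (v *m B *m v^T) 0 0.
  have [->|v0] := eqVneq v 0; first by rewrite !mul0mx !mxE mulr0.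
  have r0 : 0 < (v *m v^T) 0 0.
    by rewrite lt_def q_ge0 andbT; apply: contra_neq v0; exact: q_eq0.
  pose s := Num.sqrt ((v *m v^T) 0 0).
  have s0 : 0 < s by rewrite sqrtr_gt0.
  have sE : s ^+ 2 = (v *m v^T) 0 0 by rewrite sqr_sqrtr ?q_ge0.
  have scE (D : 'M[R]_n) : ((s^-1 *: v) *m D *m (s^-1 *: v)^T) 0 0 =
      (v *m D *m v^T) 0 0 / s ^+ 2.
    rewrite linearZ/= -!scalemxAl -scalemxAr scalerA mxE mulrC.
    by rewrite -invfM -expr2.
  have /minc : s^-1 *: v \in S.
    by rewrite inE /S/= qE scE -qE -sE divff// sqrf_eq0 gt_eqF.
  by rewrite scE -sE ler_pdivlMr ?exprn_gt0.
exists a => //; apply/eigenvalueP; exists c; last first.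
  apply/eqP => c0; move: Sc; rewrite c0 /S/= mul0mx mxE => /eqP.
  by rewrite eq_sym oner_eq0.
have formE (v : 'rV[R]_n) : (v *m (B - a%:M) *m v^T) 0 0 =
    (v *m B *m v^T) 0 0 - a * (v *m v^T) 0 0.
  rewrite mulmxBr mulmxBl mul_mx_scalar -scalemxAl.
  by move: (v *m B *m v^T) (v *m v^T) => X Y; rewrite !mxE.
apply/eqP; rewrite -subr_eq0 -mul_mx_scalar -mulmxBr; apply/eqP.
apply: psd_isotropic_ker.
- by apply/matrixP => i j; rewrite !mxE -[in RHS]symB mxE eq_sym.
- by move=> v; rewrite formE subr_ge0.
- by rewrite formE Sc mulr1 subrr.
Qed.

(** The infimum in [sigma_min] is attained. With a the least eigenvalue of A^T A, an eigenvector v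
    for b satisfies b |v|^2 = |A v|^2 >= a |v|^2, so [Num.sqrt a] is both a singular value and a
    lower bound of all of them. *)
Lemma min_singular_value (R : realType) (N K : nat) (A : 'M[R]_(N, K)) :
  (0 < K)%N -> exists2 a, eigenvalue (A^T *m A) a &
    sigma_min A = Num.sqrt a /\
    forall v : 'cV[R]_K, Num.sqrt a * norm2 v <= norm2 (A *m v).
Proof.
move=> K0; have symB : (A^T *m A)^T = A^T *m A by rewrite trmx_mul trmxK.
have [a ea aP] := symmetric_min_eigenvalue K0 symB.
have normA (v : 'rV_K) : (v *m (A^T *m A) *m v^T) 0 0 = norm2 (A *m v^T) ^+ 2.
  by rewrite norm2_sqr trmx_mul trmxK !mulmxA.
have normv (v : 'rV_K) : (v *m v^T) 0 0 = norm2 v^T ^+ 2.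
  by rewrite norm2_sqr trmxK.
have eig_le b v : v *m (A^T *m A) = b *: v -> v != 0 ->
    b * norm2 v^T ^+ 2 = norm2 (A *m v^T) ^+ 2 /\ 0 < norm2 v^T ^+ 2.
  move=> vE v0; rewrite -normA vE -scalemxAl mxE normv; split => //.
  by rewrite lt_def sqr_ge0 andbT sqrf_eq0 norm2_eq0 trmx_eq0.
have a0 : 0 <= a.
  have /eigenvalueP[v vE v0] := ea.
  have [avE v_gt0] := eig_le _ _ vE v0.
  by rewrite -(pmulr_lge0 _ v_gt0) avE sqr_ge0.
exists a => //; split; last first.
  move=> v.
  rewrite -(ler_pXn2r (n := 2)) ?nnegrE ?mulr_ge0 ?norm2_ge0 ?sqrtr_ge0//.
  by rewrite exprMn sqr_sqrtr//; have := aP v^T; rewrite normA normv trmxK.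
have sa : singular_values A (Num.sqrt a) by exists a.
apply/eqP; rewrite eq_le; apply/andP; split.
  by apply: ge_inf => //; exists 0 => _ [b _ <-]; exact: sqrtr_ge0.
apply: lb_le_inf; first by exists (Num.sqrt a).
move=> _ [b /eigenvalueP[v vE v0] <-]; apply: ler_wsqrtr.
have [bvE v_gt0] := eig_le _ _ vE v0.
by rewrite -(ler_pM2r v_gt0) bvE -normA -normv.
Qed.

(** An eigenvector v for a has a |v|^2 = |A v|^2, which is positive because A is injective. *)
Lemma sigma_min_gt0 (R : realType) (N K : nat) (A : 'M[R]_(N, K)) :
  (0 < K)%N -> \rank A = K -> 0 < sigma_min A.
Proof.
move=> K0 rA; have [a /eigenvalueP[v vE v0] [-> _]] := min_singular_value A K0.
have v_gt0 : 0 < norm2 v^T ^+ 2.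
  by rewrite lt_def sqr_ge0 andbT sqrf_eq0 norm2_eq0 trmx_eq0.
rewrite sqrtr_gt0 -(pmulr_lgt0 _ v_gt0) norm2_sqr trmxK.
have -> : a * (v *m v^T) 0 0 = norm2 (A *m v^T) ^+ 2.
  rewrite norm2_sqr trmx_mul trmxK mulmxA -(mulmxA v) vE -scalemxAl.
  by rewrite [RHS]mxE.
rewrite lt_def sqr_ge0 andbT sqrf_eq0 norm2_eq0.
apply: contra_neq v0 => /(full_rank_mul_inj rA) v0.
by apply: trmx_inj; rewrite v0 trmx0.
Qed.

Lemma sigma_min_mul_norm2 (R : realType) (N K : nat) (A : 'M[R]_(N, K))
    (v : 'cV[R]_K) : (0 < K)%N -> sigma_min A * norm2 v <= norm2 (A *m v).
Proof. by move=> K0; have [a _ [-> ->]] := min_singular_value A K0. Qed.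

(** * The least squares map *)

Lemma least_squares_mul (R : realType) (N K : nat) (A : 'M[R]_(N, K))
    (v : 'cV[R]_K) : \rank A = K -> least_squares A (A *m v) = v.
Proof.
move=> rA; rewrite /least_squares -!mulmxA (mulmxA A^T).
by rewrite mulKmx// gram_unitmx.
Qed.

Lemma least_squaresD (R : realType) (N K : nat) (A : 'M[R]_(N, K))
    (u v : 'cV[R]_N) :
  least_squares A (u + v) = least_squares A u + least_squares A v.
Proof. exact: mulmxDr. Qed.

Lemma norm2_least_squares (R : realType) (N K : nat) (A : 'M[R]_(N, K))
    (u : 'cV[R]_N) : (0 < K)%N -> \rank A = K ->
  norm2 (least_squares A u) <= norm2 u / sigma_min A.
Proof.
move=> K0 rA; rewrite ler_pdivlMr ?sigma_min_gt0// mulrC.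
apply: le_trans (sigma_min_mul_norm2 _ _ K0) _.
set w := least_squares A u; set p := A *m w.
(* This is the normal equation A^T A w = A^T u paired with w. Cauchy-Schwarz then gives |p|^2 <= |p|
   |u|. *)
have pp : norm2 p ^+ 2 = (p^T *m u) 0 0.
  rewrite norm2_sqr {2}/p /w /least_squares trmx_mul -!mulmxA.
  by rewrite (mulmxA A^T A) mulKVmx ?gram_unitmx// (mulmxA w^T) -trmx_mul.
have [->|p0] := eqVneq (norm2 p) 0; first exact: norm2_ge0.
have {}p0 : 0 < norm2 p by rewrite lt_def p0 norm2_ge0.
by rewrite -(ler_pM2l p0) -expr2 pp cauchy_schwarz.
Qed.

(** * First two moments of the centred normal law *)

Section normal_moments.
Context {R : realType} (s : R) (s0 : s != 0).
Local Notation mu := (@lebesgue_measure R).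
Local Notation f := (normal_pdf 0 s).
Local Notation N := (normal_prob 0 s).

(** The Radon-Nikodym derivative of the normal law agrees almost everywhere with its density,
    because both have the same integral over every measurable set. *)
Lemma ge0_integral_normal_prob (g : R -> \bar R) :
  measurable_fun setT g -> (forall x, 0 <= g x)%E ->
  (\int[N]_x g x = \int[mu]_x (g x * (f x)%:E))%E.
Proof.
move=> mg g0.
have domN := @normal_prob_dominates R 0 s.
rewrite -(Radon_Nikodym_SigmaFinite.change_of_variables domN g0 measurableT mg).
have idens := Radon_Nikodym_SigmaFinite.f_integrable domN.
have mf : measurable_fun [set: R] (fun x => (f x)%:E).
  by apply/measurable_EFinP; exact: measurable_normal_pdf.
apply: ae_eq_integral => //.
- by apply: emeasurable_funM => //; exact: measurable_int idens.
- exact: emeasurable_funM.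
- apply: ae_eqe_mul2l; apply: integral_ae_eq => // E _ mE.
  by rewrite -Radon_Nikodym_SigmaFinite.f_integral.
Qed.

Lemma is_derive_normal_pdf (x : R) :
  is_derive x 1 (f : R -> R) (- (x / s ^+ 2) * f x).
Proof.
have -> : (f : R -> R) =
    (fun x => normal_peak s * expR (- (2 * s ^+ 2)^-1 * x ^+ 2)).
  apply/funext => y; rewrite normal_pdfE// /normal_fun subr0.
  congr (_ * expR _).
  by field.
set k := - _^-1.
have dk : is_derive x 1 (fun y : R => k * y ^+ 2) (k * (2 * x)).
  apply: is_derive_eq; rewrite /GRing.scale/=; ring.
by apply: is_derive_eq; rewrite /GRing.scale/= /k; field.
Qed.

(** With t = x^2 / (2 s^2), the inequality exp t >= 1 + t > t gives exp(-t) <= 1/t, so x f(x) is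
    squeezed between 0 and c/x. *)
Lemma cvg_id_normal_pdf : x * f x @[x --> +oo] --> (0 : R).
Proof.
pose c := normal_peak s * (s ^+ 2 *+ 2).
have s20 : 0 < s ^+ 2 *+ 2 by rewrite pmulrn_lgt0// exprn_even_gt0.
apply: (@squeeze_cvgr _ _ _ _ (fun=> 0) (fun x => c * x^-1)); last 2 first.
- exact: cvg_cst.
- rewrite -[X in _ --> X](mulr0 c); apply: cvgMl_tmp.
  apply/gtr0_cvgV0; last exact: cvg_id.
  exact: nbhs_pinfty_gt.
near=> x.
have x0 : 0 < x by near: x; exact: nbhs_pinfty_gt.
rewrite mulr_ge0 ?normal_pdf_ge0 ?(ltW x0)//=.
rewrite normal_pdfE//.
rewrite /normal_fun subr0 /c.
rewrite mulrCA -[leRHS]mulrA ler_wpM2l ?normal_peak_ge0// mulNr expRN.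
have t0 : 0 < x ^+ 2 / (s ^+ 2 *+ 2) by rewrite divr_gt0 ?exprn_gt0.
have -> : s ^+ 2 *+ 2 / x = x / (x ^+ 2 / (s ^+ 2 *+ 2)).
  by field; rewrite s0 gt_eqF.
rewrite ler_wpM2l ?ltW// ltf_pV2 ?posrE ?expR_gt0//.
by apply: lt_le_trans (expR_ge1Dx _); rewrite ltrDr.
Unshelve. all: by end_near. Qed.

(** Seen as a random variable under the normal law, the identity has the normal distribution
    function as its cdf; this yields the limit 1 of [G] at infinity. *)
Let idTR : measurableTypeR R -> R := idfun.

#[local] HB.instance Definition _ :=
  @isMeasurableFun.Build _ _ _ _ idTR (@measurable_id _ _ setT).

Let G (x : R) : R := fine (cdf (idTR : {RV N >-> R}) x).

Let GE (x : R) : G x = \int[mu]_(t in `]-oo, x]) f t.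
Proof. by rewrite /G /cdf /distribution /pushforward /= preimage_id. Qed.

Let is_derive_G (x : R) : is_derive x 1 G (f x).
Proof.
have -> : G = (fun x : R => \int[mu]_(t in `]-oo, x]) f t) by exact/funext.
have [] := @continuous_FTC1 R f -oo%O x (x + 1).
- by rewrite ltrDl.
- exact: integrableS (@integrable_normal_pdf R 0 s).
- exact: ltNyr.
- exact: continuous_normal_pdf.
by move=> dG <-; rewrite derive1E; apply: DeriveDef.
Qed.

Let cvg_G : G x @[x --> +oo] --> (1 : R).
Proof. by apply: fine_cvg; exact: cvg_cdfy1. Qed.

Let half_mass : (\int[mu]_(x in `[0%R, +oo[) (f x)%:E = (1 - G 0)%:E)%E.
Proof.
rewrite (@ge0_continuous_FTC2y R f G 0 1)//.
- by move=> x _; exact: normal_pdf_ge0.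
- by apply: continuous_subspaceT; exact: continuous_normal_pdf.
- by move=> x _; exact: ex_derive.
- apply: cvg_at_right_filter; apply: differentiable_continuous.
  by apply/derivable1_diffP; exact: ex_derive.
- by move=> x _; have dG := is_derive_G x; rewrite derive1E derive_val.
Qed.

Let set_ge0E : [set x : R | 0 <= x] = `[0, +oo[%classic.
Proof. by rewrite set_itvcy. Qed.

(** The density is even with total mass 1, and its mass on the half-line is 1 - G 0. *)
Let half_massE : 2 * (1 - G 0) = 1.
Proof.
have := @integral_normal_pdf R 0 s; rewrite ge0_symfun_integralT.
- by rewrite set_ge0E half_mass -EFinM => -[].
- by move=> x; exact: normal_pdf_ge0.
- exact: continuous_normal_pdf.
- by move=> x /=; rewrite !normal_pdfE// /normal_fun !subr0 sqrrN.
Qed.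

Lemma integral_sqr_normal_pdf :
  (\int[mu]_x (x ^+ 2 * f x)%:E = (s ^+ 2)%:E)%E.
Proof.
have cf : continuous (fun x : R => x ^+ 2 * f x).
  move=> x; apply: cvgM; first exact: sqr_continuous.
  exact: continuous_normal_pdf.
rewrite ge0_symfun_integralT//; last 2 first.
- by move=> x; rewrite mulr_ge0 ?sqr_ge0 ?normal_pdf_ge0.
- by move=> x /=; rewrite !normal_pdfE// /normal_fun !subr0 sqrrN.
(* Since f' = - (x / s^2) f, this is an antiderivative of x^2 f. *)
pose F (x : R) : R := s ^+ 2 * (G x - x * f x).
have dF (x : R) : is_derive x 1 F (x ^+ 2 * f x).
  have df := is_derive_normal_pdf x; have dG := is_derive_G x.
  by rewrite /F; apply: is_derive_eq; rewrite /GRing.scale/=; field.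
(* [F] goes from s^2 G(0) at 0 to s^2 at infinity, so twice its increment is s^2 * 2(1 - G 0) =
   s^2. *)
rewrite set_ge0E (@ge0_continuous_FTC2y R _ F 0 (s ^+ 2))//.
- rewrite /F mul0r subr0 -EFinB -EFinM; congr EFin.
  transitivity (s ^+ 2 * (2 * (1 - G 0))); first by ring.
  by rewrite half_massE mulr1.
- by move=> x _; rewrite mulr_ge0 ?sqr_ge0 ?normal_pdf_ge0.
- exact: continuous_subspaceT.
- rewrite -[X in _ --> X]mulr1; apply: cvgMl_tmp.
  rewrite -[X in _ --> X]subr0; apply: cvgB; first exact: cvg_G.
  exact: cvg_id_normal_pdf.
- apply: cvg_at_right_filter; apply: differentiable_continuous.
  by apply/derivable1_diffP; have dF0 := dF 0; exact: ex_derive.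
- by move=> x _; have dFx := dF x; rewrite derive1E derive_val.
Qed.

End normal_moments.

(** Each integral splits at 0 into two integrals over the positive half-line; the reflection merely
    exchanges them. *)
Lemma integralT_oppr (R : realType) (h : R -> R) :
  continuous h -> (forall x, 0 <= h x) ->
  (\int[@lebesgue_measure R]_x (h (- x))%:E =
   \int[@lebesgue_measure R]_x (h x)%:E)%E.
Proof.
move=> ch h0.
have half (g : R -> R) : continuous g -> (forall x, 0 <= g x) ->
    (\int[@lebesgue_measure R]_x (g x)%:E =
     \int[@lebesgue_measure R]_(x in `[0%R, +oo[) (g (- x))%:E +
     \int[@lebesgue_measure R]_(x in `[0%R, +oo[) (g x)%:E)%E.
  move=> cg g0.
  have mg : measurable_fun [set: R] g by exact: continuous_measurable_fun.
  rewrite -(setUv `[0%R, +oo[%classic) ge0_integral_setU//=; last 4 first.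
  - exact: measurableC.
  - by apply/measurable_EFinP; rewrite setUv.
  - by move=> x _; rewrite lee_fin.
  - exact/disj_setPCl.
  rewrite addeC setCitvr; congr (_ + _)%E.
  (* The complement of the half-line omits 0; adding this null point closes the interval for the
     substitution. *)
  rewrite integral_itv_bndo_bndc; last exact/measurable_EFinP/measurable_funTS.
  rewrite -{1}oppr0 ge0_integration_by_substitutionNy//.
  exact: continuous_subspaceT.
rewrite (half (fun x => h (- x))); last 2 first.
- by move=> x; apply: continuous_comp; [exact: oppr_continuous | exact: ch].
- by move=> x; exact: h0.
rewrite (half h)// addeC; congr (_ + _)%E.
by apply: eq_integral => x _; rewrite opprK.
Qed.

Lemma integral_sqr_normal_prob (R : realType) (s : R) : s != 0 ->
  (\int[normal_prob 0 s]_x (x ^+ 2)%:E = (s ^+ 2)%:E)%E.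
Proof.
move=> s0; rewrite ge0_integral_normal_prob//.
- by under eq_integral do rewrite -EFinM; exact: integral_sqr_normal_pdf.
- by apply/measurable_EFinP; exact: measurable_funX.
- by move=> x; rewrite lee_fin sqr_ge0.
Qed.

Lemma integrable_sqr_Lfun2 (d : measure_display) (T : measurableType d)
    (R : realType) (mu : {measure set T -> \bar R}) (f : T -> R) :
  measurable_fun setT f -> (\int[mu]_x (f x ^+ 2)%:E < +oo)%E ->
  f \in Lfun mu 2%:E.
Proof.
move=> mf f2; rewrite inE; apply/andP; split; rewrite inE//=.
rewrite /finite_norm unlock /=; apply: poweR_lty.
under eq_integral do rewrite powR_mulrn// -normrX ger0_norm ?sqr_ge0//.
exact: f2.
Qed.

Lemma id_normal_prob_Lfun2 (R : realType) (s : R) : s != 0 ->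
  (idfun : measurableTypeR R -> R) \in Lfun (normal_prob 0 s) 2%:E.
Proof.
move=> s0; apply: integrable_sqr_Lfun2; first exact: measurable_id.
by rewrite /= integral_sqr_normal_prob// ltry.
Qed.

(** By evenness of the density, the positive and negative parts of x integrate to mirror images of
    each other, hence to equal values. These are finite because the second moment is, so their
    difference is 0. *)
Lemma integral_id_normal_prob (R : realType) (s : R) : s != 0 ->
  (\int[normal_prob 0 s]_x x%:E = 0)%E.
Proof.
move=> s0.
have /Lfun1_integrable iid :
    (idfun : measurableTypeR R -> R) \in Lfun (normal_prob 0 s) 1.
  apply: Lfun_subset12; first exact: fin_num_measure.
  exact: id_normal_prob_Lfun2.
rewrite integralE.
pose h (x : R) : R := Num.max x 0 * normal_pdf 0 s x.
have posE : (\int[normal_prob 0 s]_x (EFin^\+ x) =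
    \int[lebesgue_measure]_x (h x)%:E)%E.
  rewrite ge0_integral_normal_prob//; last exact: measurable_funepos.
  by apply: eq_integral => x _; rewrite funeposE -EFin_max -EFinM.
have negE : (\int[normal_prob 0 s]_x (EFin^\- x) =
    \int[lebesgue_measure]_x (h (- x))%:E)%E.
  rewrite ge0_integral_normal_prob//; last exact: measurable_funeneg.
  apply: eq_integral => x _; rewrite funenegE -EFinN -EFin_max -EFinM.
  by rewrite /h !normal_pdfE// /normal_fun !subr0 sqrrN.
have ch : continuous h.
  move=> x; apply: cvgM; last exact: continuous_normal_pdf.
  by apply: continuous_max; [exact: cvg_id | exact: cvg_cst].
rewrite posE negE integralT_oppr//; last first.
  by move=> x; rewrite mulr_ge0 ?normal_pdf_ge0// le_max lexx orbT.
rewrite subee// -posE.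
have := integrable_funepos measurableT iid.
by move/integrable_fin_num; apply.
Qed.

(** * Transfer of the moments to a Gaussian random variable *)

Section gaussian_random_variable.
Context (d : measure_display) (T : measurableType d) (R : realType)
  (P : probability T R) (s : R) (X : {RV P >-> R}) (s0 : s != 0)
  (distX : forall A : set R, measurable A ->
    distribution P X A = normal_prob 0 s A).

(* The Borel sigma-algebra of [R] is registered under two displays:
   [normal_prob] lives on [measurableTypeR R], whereas [X] has codomain [R]. *)
Let phi : T -> measurableTypeR R := X.

Let measurable_phi : measurable_fun setT phi.
Proof. exact: (@measurable_funPT _ _ _ _ X). Qed.

Let pushforward_phi (f : measurableTypeR R -> \bar R) :
  (\int[pushforward P phi]_x f x = \int[normal_prob 0 s]_x f x)%E.
Proof. by apply: eq_measure_integral => A mA _; exact: distX. Qed.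

Lemma gaussian_sqr_expectation : ('E_P[(fun w => X w ^+ 2)%R] = (s ^+ 2)%:E)%E.
Proof.
rewrite unlock -(integral_sqr_normal_prob s0).
rewrite -pushforward_phi ge0_integral_pushforward//.
- by apply/measurable_EFinP; exact: measurable_funX.
- by move=> x; rewrite lee_fin sqr_ge0.
Qed.

Lemma gaussian_Lfun2 : (X : T -> R) \in Lfun P 2%:E.
Proof.
apply: integrable_sqr_Lfun2 => //.
by have := gaussian_sqr_expectation; rewrite unlock => ->; rewrite ltry.
Qed.

Lemma gaussian_Lfun1 : (X : T -> R) \in Lfun P 1.
Proof.
by apply: Lfun_subset12; [exact: fin_num_measure | exact: gaussian_Lfun2].
Qed.

Lemma gaussian_expectation : ('E_P[X] = 0)%E.
Proof.
rewrite unlock -[RHS](integral_id_normal_prob s0).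
rewrite -pushforward_phi integral_pushforward//.
exact/Lfun1_integrable/gaussian_Lfun1.
Qed.

End gaussian_random_variable.

(** * Independence and second-order statistics of white noise *)

Section second_order.
Context (d : measure_display) (T : measurableType d) (R : realType)
  (P : probability T R).

(** A product measure is determined by its values on rectangles, so the factorisation identifies the
    law of (X, Y) with the product of the two laws. Fubini then separates the factors. *)
Lemma independent_expectationM (X Y : {RV P >-> R}) :
  (forall A B : set R, measurable A -> measurable B ->
     P (X @^-1` A `&` Y @^-1` B) = (P (X @^-1` A) * P (Y @^-1` B))%E) ->
  (X : T -> R) \in Lfun P 1 -> (Y : T -> R) \in Lfun P 1 ->
  (X \* Y : T -> R) \in Lfun P 1 ->
  ('E_P[X \* Y] = 'E_P[X] * 'E_P[Y])%E.
Proof.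
move=> indXY X1 Y1 /Lfun1_integrable XY1.
have EY : ('E_P[Y])%E \is a fin_num by exact: expectation_fin_num.
move: X1 Y1 => /Lfun1_integrable iX /Lfun1_integrable iY.
pose phi (w : T) : R * R := (X w, Y w).
have mphi : measurable_fun setT phi by exact: measurable_fun_pair.
pose m : R * R -> \bar R := fun p => (p.1 * p.2)%:E.
have mm : measurable_fun setT m.
  by apply/measurable_EFinP; apply: measurable_funM.
have prodE (f : R * R -> \bar R) :
    (\int[distribution P X \x distribution P Y]_p f p =
     \int[pushforward P phi]_p f p)%E.
  apply: eq_measure_integral => C mC _.
  by apply: product_measure_unique => // A B mA mB; exact: indXY.
(* Fubini needs integrability under the product law; it is carried over from that of X Y under P. *)
have im : (distribution P X \x distribution P Y)%E.-integrable setT m.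
  apply/integrableP; split => //.
  rewrite prodE ge0_integral_pushforward//; last exact: measurableT_comp.
  by have /integrableP[] := XY1.
rewrite [in LHS]unlock.
transitivity (\int[pushforward P phi]_p m p)%E.
  by rewrite integral_pushforward.
rewrite -prodE -integral12_prod_meas1//.
transitivity (\int[distribution P X]_x ('E_P[Y] * x%:E))%E.
  apply: eq_integral => x _; rewrite /fubini_F /m /=.
  under eq_integral do rewrite EFinM.
  rewrite integralZl//; last first.
    apply/integrableP; split => //.
    rewrite ge0_integral_distribution//; last exact: measurableT_comp.
    by have /integrableP[] := iY.
  by rewrite integral_distribution// muleC unlock.
rewrite -(fineK EY) integralZl//; last first.
  apply/integrableP; split => //.
  rewrite ge0_integral_distribution//; last exact: measurableT_comp.
  by have /integrableP[] := iX.
by rewrite integral_distribution// muleC; congr (_ * _)%E; rewrite unlock.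
Qed.

(** Take the whole line for every index other than i and j: those factors are 1 and impose no
    constraint on the intersection. *)
Lemma mutually_independent_pair (n : nat) (X : 'I_n -> {RV P >-> R})
    (i j : 'I_n) (A B : set R) :
  mutually_independent X -> i != j -> measurable A -> measurable B ->
  P (X i @^-1` A `&` X j @^-1` B) = (P (X i @^-1` A) * P (X j @^-1` B))%E.
Proof.
move=> indX ij mA mB.
pose C k := if k == i then A else if k == j then B else setT.
have Ci : C i = A by rewrite /C eqxx.
have Cj : C j = B by rewrite /C eq_sym (negbTE ij) eqxx.
have mC k : measurable (C k) by rewrite /C; case: ifP => // _; case: ifP.
have := indX C mC.
rewrite (bigD1 i)//= (bigD1 j) 1?eq_sym//= big1 ?mule1; last first.
  move=> k /andP[/negbTE ki /negbTE kj].
  by rewrite /C ki kj preimage_setT probability_setT.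
rewrite Ci Cj => <-; congr (P _).
apply/seteqP; split => [w [Aw Bw] k _|w Cw]; last first.
  by split; [rewrite -Ci; exact: Cw | rewrite -Cj; exact: Cw].
rewrite /C /preimage /=; case: eqVneq => [->//|_]; by case: eqVneq => [->|].
Qed.

Lemma Lfun_lincomb (I : finType) (r : R) (c : I -> R) (Z : I -> T -> R) :
  1 <= r -> (forall i, Z i \in Lfun P r%:E) ->
  (fun w => \sum_i c i * Z i w) \in Lfun P r%:E.
Proof.
move=> r1 Zr.
have -> : (fun w => \sum_i c i * Z i w) = \sum_i (c i \o* Z i).
  apply/funext => w; rewrite fct_sumE.
  by apply: eq_bigr => i _ /=; rewrite mulrC.
have r1' : (1 <= r%:E)%E by rewrite lee_fin.
by rewrite rpred_sum// => i _; exact: Lfun_scale.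
Qed.

Lemma expectation_lincomb (I : finType) (c : I -> R) (Z : I -> T -> R) :
  (forall i, Z i \in Lfun P 1) ->
  ('E_P[fun w => (\sum_i c i * Z i w)%R] = \sum_i (c i)%:E * 'E_P[Z i])%E.
Proof.
move=> Z1.
have -> : (fun w => \sum_i c i * Z i w) =
    \sum_(f <- [seq c i \o* Z i | i : I]) f.
  apply/funext => w; rewrite big_image/= fct_sumE.
  by apply: eq_bigr => i _ /=; rewrite mulrC.
rewrite expectation_sum => [|f /mapP[i _ ->]]; last exact: Lfun_scale.
by rewrite big_image/=; apply: eq_bigr => i _; rewrite expectationZl.
Qed.

Context (n : nat) (s : R) (z : 'I_n -> {RV P >-> R}) (s0 : 0 < s)
  (wz : white_gaussian s z).

Let sn0 : s != 0. Proof. by rewrite gt_eqF. Qed.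

Let z2 i : (z i : T -> R) \in Lfun P 2%:E.
Proof. exact: (gaussian_Lfun2 sn0 (wz.1 i)). Qed.

Let z1 i : (z i : T -> R) \in Lfun P 1.
Proof. exact: (gaussian_Lfun1 sn0 (wz.1 i)). Qed.

Lemma white_gaussian_Lfun2 (a : 'I_n -> R) :
  (fun w => \sum_k a k * z k w) \in Lfun P 2%:E.
Proof. by apply: Lfun_lincomb => //; rewrite ler1n. Qed.

Lemma white_gaussian_mean (a : 'I_n -> R) :
  ('E_P[fun w => (\sum_k a k * z k w)%R] = 0)%E.
Proof.
rewrite expectation_lincomb// big1// => k _.
by rewrite (gaussian_expectation sn0 (wz.1 k)) mule0.
Qed.

(** Expanding over pairs (k, l), the diagonal terms give the second moment s^2, and the others
    vanish as products of zero means. *)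
Lemma white_gaussian_correlation (a b : 'I_n -> R) :
  ('E_P[fun w => ((\sum_k a k * z k w) * (\sum_k b k * z k w))%R] =
   (s ^+ 2 * \sum_k a k * b k)%:E)%E.
Proof.
have -> : (fun w => (\sum_k a k * z k w) * (\sum_k b k * z k w)) =
    (fun w => \sum_(p : 'I_n * 'I_n) (a p.1 * b p.2) * (z p.1 \* z p.2) w).
  apply/funext => w; rewrite big_distrlr pair_big/=.
  by apply: eq_bigr => p _; rewrite mulrACA.
rewrite expectation_lincomb => [|p]; last exact: Lfun2_mul_Lfun1.
have zz k l : 'E_P[z k \* z l]%E = ((s ^+ 2) *+ (k == l))%:E.
  have [<-|kl] := eqVneq k l.
    by rewrite mulr1n -(gaussian_sqr_expectation sn0 (wz.1 k)).
  rewrite independent_expectationM//; last exact: Lfun2_mul_Lfun1.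
    by rewrite !(gaussian_expectation sn0 (wz.1 _)) mule0 mulr0n.
  by move=> A B; exact: (mutually_independent_pair wz.2 kl).
under eq_bigr do rewrite zz -EFinM.
rewrite sumEFin; congr EFin.
rewrite -(pair_bigA _ (fun k l => a k * b l * (s ^+ 2 *+ (k == l))))/=.
rewrite mulr_sumr.
apply: eq_bigr => k _; rewrite (bigD1 k)//= eqxx mulr1n big1 ?addr0 1?mulrC//.
by move=> l /negbTE; rewrite eq_sym => ->; rewrite mulr0n mulr0.
Qed.

End second_order.

(** * Statistics and error bound of the estimator *)

Lemma least_squares_col (R : realType) (N K : nat) (A : 'M[R]_(N, K))
    (u : 'cV[R]_N) (i : 'I_K) :
  least_squares A u i 0 = \sum_k (invmx (A^T *m A) *m A^T) i k * u k 0.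
Proof. by rewrite /least_squares mxE. Qed.

(** The Gram matrix is symmetric, so the transposed factor is A (A^T A)^-1 and the inner A^T A
    cancels one inverse. *)
Lemma pinv_mul_tr (R : realType) (N K : nat) (A : 'M[R]_(N, K)) :
  \rank A = K -> (invmx (A^T *m A) *m A^T) *m (invmx (A^T *m A) *m A^T)^T =
  invmx (A^T *m A).
Proof.
move=> rA; rewrite trmx_mul trmxK trmx_inv trmx_mul trmxK -mulmxA (mulmxA A^T).
by rewrite mulmxV ?gram_unitmx// mulmx1.
Qed.

Theorem proposition1 (R : realType) (M K : nat) (hK : (1 <= K)%N)
    (hKM : (K <= M)%N) (S : {set 'I_M}) (sigma : R) (hsigma : 0 < sigma)
    (g : 'cV[R]_M) (hg : forall m, 0 <= g m 0)
    (hrank : \rank (subrows S (trunc_dct R hKM)) = K) :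
  let Psi := trunc_dct R hKM in
  let PsiS := subrows S Psi in
  let omega_hat (y : 'cV[R]_#|S|) := least_squares PsiS y in
  let g_hat (y : 'cV[R]_#|S|) := Psi *m omega_hat y in
  (forall (d : measure_display) (T : measurableType d) (P : probability T R)
      (omega : 'cV[R]_K) (z : 'I_#|S| -> {RV P >-> R}) (y : T -> 'cV[R]_#|S|),
    g = Psi *m omega ->
    white_gaussian sigma z ->
    (forall w, y w = subrows S g + \col_i z i w) ->
    [/\ mean_vec P (fun w => omega_hat (y w)) = map_mx EFin omega,
        cov_mx P (fun w => omega_hat (y w)) =
          map_mx EFin (sigma ^+ 2 *: invmx (PsiS^T *m PsiS)) &
        expectation P (fun w => norm2 (g_hat (y w) - g) ^+ 2) =
          (sigma ^+ 2 * \tr (invmx (PsiS^T *m PsiS)))%:E])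
  /\
  (forall (omega : 'cV[R]_K) (eK : 'cV[R]_M) (z y : 'cV[R]_#|S|),
    omega = Psi^T *m g ->
    eK = g - Psi *m omega ->
    y = PsiS *m omega + (subrows S eK + z) ->
    norm2 (g_hat y - g) <=
      (norm2 (subrows S eK) + norm2 z) / sigma_min PsiS + norm2 eK).
Proof.
move=> Psi PsiS omega_hat g_hat.
have PsiI : Psi^T *m Psi = 1%:M := trunc_dct_orthonormal R hKM.
have subM (v : 'cV_K) : subrows S (Psi *m v) = PsiS *m v.
  by rewrite /PsiS /subrows mul_rowsub_mx.
split=> [d T P omega z y gE wz yE | omega eK z y omegaE eKE yE]; last first.
  (* The estimator reproduces [omega] exactly from [PsiS *m omega], so only the residual passes
     through it, while g itself exceeds [Psi *m omega] by [eK]. *)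
  have -> : g_hat y - g = Psi *m least_squares PsiS (subrows S eK + z) - eK.
    rewrite /g_hat /omega_hat yE (least_squaresD PsiS (PsiS *m omega)).
    rewrite least_squares_mul// mulmxDr.
    rewrite eKE opprB addrA [_ + _ *m omega]addrC -!addrA.
    by congr (_ + _); rewrite addrC.
  rewrite (le_trans (norm2D _ _))// norm2N lerD2r norm2_isometry//.
  rewrite (le_trans (norm2_least_squares _ hK hrank))//.
  by rewrite ler_pM2r ?invr_gt0 ?sigma_min_gt0// norm2D.
pose L := invmx (PsiS^T *m PsiS) *m PsiS^T.
(* [e i] is the error on the i-th coefficient: a fixed linear combination of the noise entries. *)
pose e i w := \sum_k L i k * z k w.
have omega_hatE w : omega_hat (y w) = omega + \col_i e i w.
  rewrite /omega_hat yE gE subM least_squaresD least_squares_mul//.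
  congr (_ + _); apply/colP => i; rewrite least_squares_col mxE.
  by apply: eq_bigr => k _; congr (_ * _); rewrite mxE.
have e2 i : e i \in Lfun P 2%:E by exact: (white_gaussian_Lfun2 hsigma wz).
have e1 i : e i \in Lfun P 1.
  by apply: Lfun_subset12; [exact: fin_num_measure | exact: e2].
have Ee i : ('E_P[e i] = 0)%E by exact: (white_gaussian_mean hsigma wz).
have Eee i j : ('E_P[fun w => (e i w * e j w)%R] =
    (sigma ^+ 2 * invmx (PsiS^T *m PsiS) i j)%:E)%E.
  rewrite (white_gaussian_correlation hsigma wz) -(pinv_mul_tr hrank).
  rewrite [in RHS]mxE.
  congr (_ * _)%:E; apply: eq_bigr => k _.
  by congr (_ * _); rewrite [RHS]mxE.
have Eomega i : ('E_P[fun w => (omega_hat (y w) i 0)%R] = (omega i 0)%:E)%E.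
  have -> : (fun w => omega_hat (y w) i 0) = cst (omega i 0) \+ e i.
    by apply/funext => w; rewrite omega_hatE !mxE.
  by rewrite expectationD// ?Lfun_cst// expectation_cst Ee adde0.
split.
- by apply/colP => i; rewrite !mxE Eomega.
- apply/matrixP => i j; rewrite !mxE unlock !Eomega/= -Eee.
  congr expectation; apply/funext => w.
  by rewrite !fctE/= omega_hatE !mxE; congr (_ * _); rewrite addrAC subrr add0r.
(* As [Psi] is an isometry, the squared error is the sum of the squares of the [e i], whose
   expectations are the diagonal covariance entries and add up to the trace. The coefficient 1 puts
   the sum in the form of a linear combination. *)
- have -> : (fun w => norm2 (g_hat (y w) - g) ^+ 2) =
      (fun w => \sum_i 1 * (e i \* e i) w).
    apply/funext => w; rewrite /g_hat gE -mulmxBr norm2_isometry// omega_hatE.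
    rewrite addrAC subrr add0r norm2_sqr mxE; apply: eq_bigr => i _.
    by rewrite !mxE mul1r.
  rewrite expectation_lincomb => [|i]; last exact: Lfun2_mul_Lfun1.
  under eq_bigr do rewrite Eee mul1e.
  by rewrite sumEFin -mulr_sumr.
Qed.
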